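(* Let $n$ and $m$ be positive integers with $m\geq n+1$. For every integer $r$ with $1\leq r\leq m-1$, the number of $(n,m)$-lattice paths $P$ with $RML(P)=r$ equals the number of $(n,m)$-lattice paths $P=(x_1,y_1)(x_2,y_2)\cdots(x_{n+1},y_{n+1})$ with $RML(P)=0$ and $x_{n+1}=1$; in particular it is independent of $r$.
   Context: An $(n,m)$-lattice path is a sequence $P=(x_1,y_1)(x_2,y_2)\cdots(x_{n+1},y_{n+1})$ of vectors in $\mathbb{Z}^2$ such that $1-n\leq y_i\leq 1$ for all $i$, $\sum_{i=1}^{n+1}y_i=1$, $1\leq x_i\leq m-1$ for all $i$, and $\sum_{i=1}^{n+1}x_i=m$. For such $P$ put $a_0=b_0=0$, $a_i=\sum_{j=1}^{i}y_j$ and $b_i=\sum_{j=1}^{i}x_j$ for $1\leq i\leq n+1$, and view $P$ as the sequence of points $(b_0,a_0),\ldots,(b_{n+1},a_{n+1})$. A minimum point of $P$ is a point $(b_i,a_i)$ with $a_i\leq a_j$ for all $j\in\{0,\ldots,n+1\}$; the rightmost minimum point is the minimum point with the largest $b_i$. If $(b_i,a_i)$ is the rightmost minimum point, $RML(P)=b_i$ is the rightmost minimum length of $P$. *)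

(* Defs.v *)
From HB Require Import structures.
From mathcomp Require Import all_boot all_order all_algebra finmap.
From mathcomp Require Import boolp classical_sets functions cardinality.
Set Implicit Arguments.
Unset Strict Implicit.
Unset Printing Implicit Defensive.
Import Order.TTheory GRing.Theory Num.Theory.
Local Open Scope ring_scope.

Section LatticePaths.
Variable n : nat.

(* Steps are indexed from 0: the vector (x_i, y_i) of the mathematical notation
   (1 <= i <= n + 1) is tnth P (i - 1); so x_(n + 1) is xstep P ord_max. *)
Definition lpath : Type := (n.+1).-tuple (int * int).

Implicit Types (P : lpath) (m : nat).

Definition xstep P (i : 'I_n.+1) : int := (tnth P i).1.
Definition ystep P (i : 'I_n.+1) : int := (tnth P i).2.

Definition is_lattice_path m P : Prop :=
  [/\ forall i, 1 - n%:Z <= ystep P i <= 1,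
      \sum_i ystep P i = 1,
      forall i, 1 <= xstep P i <= m%:Z - 1
    & \sum_i xstep P i = m%:Z].

(* The points (b_i, a_i), 0 <= i <= n + 1: sums of the first i steps. *)
Definition apt P (i : 'I_n.+2) : int := \sum_(j < n.+1 | (j < i)%N) ystep P j.
Definition bpt P (i : 'I_n.+2) : int := \sum_(j < n.+1 | (j < i)%N) xstep P j.

Definition minimum_point P (i : 'I_n.+2) : bool :=
  [forall j, apt P i <= apt P j].

(* The inner arg min only supplies a witness that a minimum point exists. *)
Definition rightmost_minimum P : 'I_n.+2 :=
  [arg max_(i > [arg min_(k < ord0) apt P k]%O | minimum_point P i) bpt P i]%O.

Definition RML P : int := bpt P (rightmost_minimum P).

Lemma rightmost_minimumP P :
  minimum_point P (rightmost_minimum P) /\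
  forall j, minimum_point P j -> bpt P j <= bpt P (rightmost_minimum P).
Proof.
rewrite /rightmost_minimum; case: arg_maxP => [|i mi maxi]; last by split.
by case: arg_minP => // i _ mini; apply/forallP => j; apply: mini.
Qed.

Lemma finite_lattice_paths m : finite_set [set P | is_lattice_path m P].
Proof.
pose f (g : {ffun 'I_n.+1 -> 'I_m.+1 * 'I_n.+1}) : lpath :=
  [tuple ((g i).1%:Z, 1 - (g i).2%:Z) | i < n.+1].
apply: (@sub_finite_set _ _ (image setT f)); last exact: finite_image.
move=> P [Hy _ Hx _].
exists [ffun i => (inord `|xstep P i|%N, inord `|1 - ystep P i|%N)] => //.
apply: eq_from_tnth => i; rewrite tnth_mktuple ffunE /=.
move: (Hy i) (Hx i); rewrite /xstep /ystep; case: (tnth P i) => x y /=.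
move=> /andP[y1 y2] /andP[x1 x2].
have x0 : 0 <= x by apply: le_trans x1.
have y0 : 0 <= 1 - y by rewrite subr_ge0.
rewrite !inordK ?gez0_abs ?subKr //.
- rewrite -ltz_nat gez0_abs //; apply: (@le_lt_trans _ _ n%:Z).
    by rewrite lerBlDr -lerBlDl.
  by rewrite ltz_nat.
- rewrite -ltz_nat gez0_abs //; apply: (le_lt_trans x2).
  by apply: (@lt_trans _ _ m%:Z); rewrite ?ltz_nat // ltrBlDr ltrDl.
Qed.

End LatticePaths.

(* Main.v *)
Require Import Defs.
From mathcomp Require Import all_boot all_order all_algebra finmap.
From mathcomp Require Import boolp classical_sets functions cardinality.
From mathcomp Require Import zify.
Import Order.TTheory GRing.Theory Num.Theory.
Local Open Scope ring_scope.

(* Moving one unit of horizontal length from the last step to the first, or, if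
   the last step has length 1, rotating it to the front, sends the paths with
   [RML = r] bijectively onto those with [RML = r + 1] when [0 < r < m - 1]; the
   first step of the image tells the two cases apart.  For [r = 0] only the
   rotation is available, and it gives the paths with [RML = 1]. *)

(** * Partial sums under rotation and transfer *)

Section PartialSums.
Variable n : nat.
Implicit Types (F : 'I_n.+1 -> int) (k : nat).

Definition psum F k : int := \sum_(j < n.+1 | (j < k)%N) F j.

(** The rightmost minimum, expressed by its index alone. Indices are naturals rather than ordinals,
    so that a rotation becomes the plain shift from [k] to [k.+1]. *)
Definition strict_min F k :=
  forall j, (j <= n.+1)%N ->
    psum F k <= psum F j /\ ((k < j)%N -> psum F k < psum F j).

Lemma psum0 F : psum F 0 = 0.
Proof. by rewrite /psum big_pred0. Qed.

Lemma psum_all F : psum F n.+1 = \sum_i F i.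
Proof. by apply: eq_bigl => i; rewrite ltn_ord. Qed.

Lemma psumS F (i : 'I_n.+1) : psum F i.+1 = psum F i + F i.
Proof.
rewrite /psum (bigD1 i) //= addrC; congr (_ + _).
by apply: eq_bigl => j; rewrite -val_eqE /=; lia.
Qed.

Lemma ltr_psum F i j : (forall l, 1 <= F l) ->
  (i < j)%N -> (j <= n.+1)%N -> psum F i < psum F j.
Proof.
move=> F1; elim: j => // j IH; rewrite ltnS leq_eqVlt => ij jn.
rewrite (psumS F (Ordinal jn)) /=; have := F1 (Ordinal jn).
case/orP: ij => [/eqP -> |ij]; first by lia.
by have := IH ij (ltnW jn); lia.
Qed.

Lemma ler_psum F i j : (forall l, 1 <= F l) ->
  (i <= j)%N -> (j <= n.+1)%N -> psum F i <= psum F j.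
Proof.
move=> F1; rewrite leq_eqVlt => /orP[/eqP -> //|ij jn].
exact/ltW/ltr_psum.
Qed.

(** Composing with the cyclic predecessor brings the last entry to the front, where every nonempty
    initial segment picks it up. *)
Lemma psum_ord_pred F k : (k <= n)%N ->
  psum (F \o @ord_pred n.+1) k.+1 = F ord_max + psum F k.
Proof.
move=> kn; rewrite /psum big_mkcond big_ord_recl /=; congr (F _ + _).
  by apply/val_inj => /=; rewrite modn_small.
rewrite [RHS]big_mkcond big_ord_recr /= ltnNge kn addr0.
apply: eq_bigr => i _; rewrite /bump /= add1n ltnS; case: ifP => // _; congr (F _).
by apply/val_inj => /=; rewrite add0n modnDr modn_small // ltnW // ltnS.
Qed.

Lemma sum_ord_pred F : \sum_i (F \o @ord_pred n.+1) i = \sum_i F i.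
Proof. by rewrite [RHS](reindex (@ord_pred n.+1)) //; exact/onW_bij/ord_pred_bij. Qed.

(* A minimum at [n] is excluded: the rotation would move it to the end of the
   path, which is never a minimum. *)
Lemma strict_min_ord_pred F k : \sum_i F i = 1 -> (k < n)%N ->
  strict_min F k -> strict_min (F \o @ord_pred n.+1) k.+1.
Proof.
move=> F1 kn mk.
have last : psum F n + F ord_max = 1 by rewrite -F1 -psum_all (psumS F ord_max).
have [_ /(_ kn) ltkn] := mk n (leqnSn n).
(* At the new origin, [F ord_max + psum F k <= 0] is needed. By integrality this is
   [psum F k < psum F n], since [psum F n + F ord_max = 1]. *)
case=> [_|j]; first by rewrite psum0 psum_ord_pred; [lia|exact: ltnW].
rewrite ltnS => jn; rewrite !psum_ord_pred ?(ltnW kn) //.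
have [] := mk j (leqW jn); lia.
Qed.

Lemma strict_min_ord_pred_inv F k : \sum_i F i = 1 -> F ord_max <= 1 ->
  (k <= n)%N -> strict_min (F \o @ord_pred n.+1) k.+1 -> strict_min F k.
Proof.
move=> F1 Fn kn mk j; rewrite leq_eqVlt => /orP[/eqP ->|].
  have [+ _] := mk 0%N isT.
  rewrite psum0 psum_ord_pred // psum_all F1.
  (* The end of the path is the one point not reached by the shift. Index 1 of the rotation is the
     origin of [F], whence [psum F k <= 0], below the final height 1. *)
  have [+ _] := mk 1%N isT; rewrite !psum_ord_pred // psum0; lia.
rewrite ltnS => jn; have [] := mk j.+1 jn.
by rewrite !psum_ord_pred // ltnS; lia.
Qed.

(** The boolean multipliers are indicators, so the two corrections cancel if [ord0] and [ord_max]
    coincide, and the total is preserved for every [n]. *)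
Definition transfer (c : int) F (i : 'I_n.+1) : int :=
  F i + (c *+ (i == ord0)) - c *+ (i == ord_max).

(** Such an initial segment contains the first entry but not the last, so it sees only the gain. *)
Lemma psum_transfer c F k : (0 < k)%N -> (k <= n)%N ->
  psum (transfer c F) k = psum F k + c.
Proof.
move=> k0 kn; rewrite /psum /transfer sumrB big_split /=.
rewrite [X in _ - X]big1 ?subr0 => [|i ik]; last first.
  by rewrite -val_eqE /= (ltn_eqF (leq_trans ik kn)).
congr (_ + _); rewrite (bigD1 ord0) //= big1 ?addr0 // => i.
by case/andP=> _ /negPf ->.
Qed.

Lemma sum_transfer c F : \sum_i transfer c F i = \sum_i F i.
Proof.
rewrite /transfer sumrB big_split /= -addrA -[RHS]addr0; congr (_ + _).
rewrite -sumrB (eq_bigr (fun i => (if i == ord0 then c else 0) -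
  (if i == ord_max then c else 0))) => [|i _].
  by rewrite sumrB -!big_mkcond !big_pred1_eq subrr.
by do 2!case: eqP.
Qed.

End PartialSums.

(** * Lattice paths and the index of their rightmost minimum *)

Section Paths.
Variable n : nat.
Implicit Types (P Q : lpath n) (m k : nat) (c r : int).

Lemma lpath_eq P Q : xstep P =1 xstep Q -> ystep P =1 ystep Q -> P = Q.
Proof.
move=> eqx eqy; apply: eq_from_tnth => i.
move: (eqx i) (eqy i); rewrite /xstep /ystep.
by case: (tnth P i) (tnth Q i) => [x y] [x' y'] /= -> ->.
Qed.

(** The upper bound on an [x]-step is automatic: the other [n >= 1] steps use up at least [n] of the
    total [m]. A transfer therefore only has to keep the steps positive. *)
Lemma lattice_pathP m P : (0 < n)%N ->
  (forall i, 1 - n%:Z <= ystep P i <= 1) -> \sum_i ystep P i = 1 ->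
  (forall i, 1 <= xstep P i) -> \sum_i xstep P i = m%:Z ->
  is_lattice_path m P.
Proof.
move=> n0 Hy Sy Hx Sx; split=> // i; rewrite Hx /=.
have ge_n : n%:Z <= \sum_(j | j != i) xstep P j.
  have -> : n%:Z = \sum_(j < n.+1 | j != i) 1.
    by rewrite sumr_const -[n]/(n.+1.-1) -[in LHS](card_ord n.+1) (cardC1 i) natz.
  exact: ler_sum.
by move: Sx; rewrite (bigD1 i) //=; move: ge_n; set S := \sum_(j < _ | _) _; lia.
Qed.

(* Since the [x]-steps are positive, [bpt] orders points by index. *)
Lemma RMLP m P r : is_lattice_path m P ->
  RML P = r <->
  exists2 k, (k <= n)%N & strict_min n (ystep P) k /\ psum n (xstep P) k = r.
Proof.
case=> _ Sy Hx Sx.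
have x1 i : 1 <= xstep P i by case/andP: (Hx i).
have [/forallP minR maxR] := rightmost_minimumP P.
rewrite /RML; move: (rightmost_minimum P) minR maxR => R minR maxR; split.
  have ltRj (j : 'I_n.+2) : (R < j)%N -> apt P R < apt P j.
    move=> Rj; rewrite lt_neqAle minR andbT; apply/eqP => eqRj.
    have /maxR : minimum_point P j by apply/forallP => l; rewrite -eqRj.
    by apply/negP; rewrite -ltNge; exact: (ltr_psum n _ R j x1 Rj (ltn_ord j)).
  move=> <-; exists R.
    (* The endpoint has height 1, above the origin, so [R] is not [n.+1]. *)
    rewrite -ltnS ltn_neqAle -ltnS ltn_ord andbT; apply/eqP => Rn.
    have : psum n (ystep P) R <= psum n (ystep P) 0 := minR ord0.
    by rewrite Rn psum_all Sy psum0.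
  split=> // j jn; split; first exact: (minR (Ordinal (jn : (j < n.+2)%N))).
  exact: (ltRj (Ordinal (jn : (j < n.+2)%N))).
case=> k kn [mk <-].
have kn2 : (k < n.+2)%N by rewrite ltnS ltnW.
have /maxR le1 : minimum_point P (Ordinal kn2).
  by apply/forallP => j; have [] := mk j (ltn_ord j).
apply/le_anti; rewrite {}le1 andbT.
(* If [R] were to the right of [k], strictness would put it above [k], against its minimality. *)
apply: (ler_psum n _ R k x1 _ (leqW kn)); rewrite leqNgt; apply/negP => kR; have [_ /(_ kR)] := mk R (ltn_ord R).
by apply/negP; rewrite -leNgt; have := minR (Ordinal kn2).
Qed.

(** * Rotation and transfer of paths, and their effect on [RML] *)

Definition rotr_path P : lpath n := [tuple tnth P (ord_pred i) | i < n.+1].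
Definition rotl_path P : lpath n := [tuple tnth P (ordS i) | i < n.+1].
Definition transfer_path c P : lpath n :=
  [tuple (transfer n c (xstep P) i, ystep P i) | i < n.+1].

Lemma rotr_pathK : cancel rotr_path rotl_path.
Proof. by move=> P; apply: eq_from_tnth => i; rewrite !tnth_mktuple ordSK. Qed.

Lemma rotl_pathK : cancel rotl_path rotr_path.
Proof. by move=> P; apply: eq_from_tnth => i; rewrite !tnth_mktuple ord_predK. Qed.

Lemma xstep_rotr P : xstep (rotr_path P) = xstep P \o @ord_pred n.+1.
Proof. by apply/funext => i; rewrite /xstep tnth_mktuple. Qed.

Lemma ystep_rotr P : ystep (rotr_path P) = ystep P \o @ord_pred n.+1.
Proof. by apply/funext => i; rewrite /ystep tnth_mktuple. Qed.

Lemma xstep_transfer c P : xstep (transfer_path c P) = transfer n c (xstep P).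
Proof. by apply/funext => i; rewrite /xstep tnth_mktuple. Qed.

Lemma ystep_transfer c P : ystep (transfer_path c P) = ystep P.
Proof. by apply/funext => i; rewrite /ystep tnth_mktuple. Qed.

Lemma transfer_path_opp c d P : c + d = 0 ->
  transfer_path c (transfer_path d P) = P.
Proof.
move=> cd; apply: lpath_eq => i; rewrite ?ystep_transfer //.
rewrite !xstep_transfer /transfer; do 2!case: eqP => _; rewrite ?mulr1n ?mulr0n; lia.
Qed.

Lemma ord_pred0 : @ord_pred n.+1 ord0 = ord_max.
Proof. by apply/val_inj; rewrite /= modn_small. Qed.

Lemma xstep_rotr0 P : xstep (rotr_path P) ord0 = xstep P ord_max.
Proof. by rewrite xstep_rotr /= ord_pred0. Qed.

Lemma xstep_rotl_max P : xstep (rotl_path P) ord_max = xstep P ord0.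
Proof. by rewrite -xstep_rotr0 rotl_pathK. Qed.

Lemma lattice_path_rotr m P : is_lattice_path m (rotr_path P) <-> is_lattice_path m P.
Proof.
rewrite /is_lattice_path xstep_rotr ystep_rotr !sum_ord_pred.
split=> -[Hy Sy Hx Sx]; split=> // i; last 1 first.
- exact: Hx (ord_pred i).
- by rewrite -(ordSK i); exact: Hy.
- by rewrite -(ordSK i); exact: Hx.
- exact: Hy (ord_pred i).
Qed.

Lemma lattice_path_rotl m P : is_lattice_path m (rotl_path P) <-> is_lattice_path m P.
Proof. by rewrite -lattice_path_rotr rotl_pathK. Qed.

(** The strict bound excludes a rightmost minimum at index [n], for which the left-hand side would
    be the full length [m]. *)
Lemma RML_rotr m P : is_lattice_path m P -> RML P + xstep P ord_max < m%:Z ->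
  RML (rotr_path P) = RML P + xstep P ord_max.
Proof.
move=> LP; have [k kn [mk <-]] := (RMLP _ _ _ LP).1 erefl => ltm.
have [_ Sy _ Sx] := LP.
have {kn} kn : (k < n)%N.
  rewrite ltn_neqAle kn andbT; apply: contraTneq ltm => ->.
  by rewrite -(psumS n (xstep P) ord_max) psum_all Sx ltxx.
apply/(RMLP m); first by apply/lattice_path_rotr.
exists k.+1 => //; rewrite xstep_rotr ystep_rotr psum_ord_pred ?(ltnW kn) //.
by split; [apply: strict_min_ord_pred | rewrite addrC].
Qed.

Lemma RML_gt0P m P : is_lattice_path m P -> 0 < RML P ->
  exists k, [/\ (0 < k <= n)%N, strict_min n (ystep P) k & psum n (xstep P) k = RML P].
Proof.
move=> LP; have [[|k] kn [mk Ek]] := (RMLP _ _ _ LP).1 erefl.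
  by rewrite -Ek psum0 ltxx.
by exists k.+1.
Qed.

(** A positive [RML] puts the minimum at an index [k.+1]. As [P] is the right rotation of
    [rotl_path P], the minimum of the latter is at [k]. *)
Lemma RML_rotl m P : is_lattice_path m P -> 0 < RML P ->
  RML (rotl_path P) = RML P - xstep P ord0.
Proof.
move=> LP /(RML_gt0P _ _ LP)[[|k] [/andP[// _ kn] mk <-]].
have LQ : is_lattice_path m (rotl_path P) by apply/lattice_path_rotl.
have [Hy Sy _ _] := LQ; apply/(RMLP _ _ _ LQ); exists k; first exact: ltnW.
split.
  apply: strict_min_ord_pred_inv => //; last first.
  - by rewrite -ystep_rotr rotl_pathK.
  - exact: ltnW.
  - by case/andP: (Hy ord_max).
rewrite -[in RHS](rotl_pathK P) xstep_rotr psum_ord_pred ?(ltnW kn) //=.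
by rewrite ord_pred0 addrC addKr.
Qed.

(** The minimum has positive index, so the first step lies to its left. When [RML P = 1] this forces
    a first step of length 1. *)
Lemma xstep0_le_RML m P : is_lattice_path m P -> 0 < RML P ->
  xstep P ord0 <= RML P.
Proof.
move=> LP /(RML_gt0P _ _ LP)[k [/andP[k0 kn] _ <-]].
have [_ _ Hx _] := LP.
have <- : psum n (xstep P) 1 = xstep P ord0.
  by rewrite (psumS n _ ord0) psum0 add0r.
by apply: ler_psum => [l||]; [case/andP: (Hx l) | | exact: ltnW].
Qed.

Lemma lattice_path_transfer m c P : (0 < n)%N ->
  is_lattice_path m P -> 1 <= xstep P ord0 + c -> 1 <= xstep P ord_max - c ->
  is_lattice_path m (transfer_path c P).
Proof.
move=> n0 [Hy Sy Hx Sx] H0 Hn.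
apply: lattice_pathP => //; rewrite ?xstep_transfer ?ystep_transfer ?sum_transfer //.
move=> i; rewrite /transfer; have /andP[xi _] := Hx i.
have [->|_] := eqVneq i ord0.
  by rewrite -val_eqE /= (ltn_eqF n0) mulr1n mulr0n subr0.
by have [->|_] := eqVneq i ord_max; rewrite ?mulr1n ?mulr0n ?addr0 ?subr0.
Qed.

(** Heights do not change, so the minimum keeps its index [k]; since [0 < k <= n], its abscissa
    gains exactly [c]. *)
Lemma RML_transfer m c P : is_lattice_path m P ->
  is_lattice_path m (transfer_path c P) -> 0 < RML P ->
  RML (transfer_path c P) = RML P + c.
Proof.
move=> LP LQ /(RML_gt0P _ _ LP)[k [/andP[k0 kn] mk <-]].
apply/(RMLP _ _ _ LQ); exists k => //.
by rewrite xstep_transfer ystep_transfer psum_transfer.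
Qed.

(** * The maps between consecutive values of [RML] *)

Definition raise P : lpath n :=
  if xstep P ord_max == 1 then rotr_path P else transfer_path 1 P.

Definition lower P : lpath n :=
  if xstep P ord0 == 1 then rotl_path P else transfer_path (-1) P.

Lemma transfer_xstep0 c P : (0 < n)%N -> xstep (transfer_path c P) ord0 = xstep P ord0 + c.
Proof.
by move=> n0; rewrite xstep_transfer /transfer -!val_eqE /= (ltn_eqF n0) mulr0n subr0.
Qed.

Lemma transfer_xstep_max c P : (0 < n)%N ->
  xstep (transfer_path c P) ord_max = xstep P ord_max - c.
Proof.
by move=> n0; rewrite xstep_transfer /transfer -!val_eqE /= (gtn_eqF n0) eqxx addr0.
Qed.

Lemma raiseK m P : (0 < n)%N -> is_lattice_path m P -> lower (raise P) = P.
Proof.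
move=> n0 [_ _ Hx _]; have /andP[x0 _] := Hx ord0.
rewrite /lower /raise; have [xm|xm] := eqVneq (xstep P ord_max) 1.
  by rewrite xstep_rotr0 xm eqxx rotr_pathK.
(* The first step was at least 1, hence is at least 2 after the transfer, and [lower] takes its
   transfer branch. *)
rewrite transfer_xstep0 // ifN; first by rewrite transfer_path_opp.
by lia.
Qed.

Lemma lowerK m P : (0 < n)%N -> is_lattice_path m P -> raise (lower P) = P.
Proof.
move=> n0 [_ _ Hx _]; have /andP[xm _] := Hx ord_max.
rewrite /lower /raise; have [x0|x0] := eqVneq (xstep P ord0) 1.
  by rewrite xstep_rotl_max x0 eqxx rotl_pathK.
rewrite transfer_xstep_max // ifN; first by rewrite transfer_path_opp.
by lia.
Qed.

(** The bound [r + 1 < m] serves the rotation; [0 < r] serves the transfer, which would leave a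
    minimum at the origin in place. *)
Lemma raiseP m r P : (0 < n)%N -> 0 < r -> r + 1 < m%:Z ->
  is_lattice_path m P /\ RML P = r ->
  is_lattice_path m (raise P) /\ RML (raise P) = r + 1.
Proof.
move=> n0 r0 rm [LP RP]; rewrite /raise.
have [xm|xm] := eqVneq (xstep P ord_max) 1.
  by split; [apply/lattice_path_rotr | rewrite (RML_rotr m) ?RP ?xm].
have [_ _ Hx _] := LP; have /andP[xm1 _] := Hx ord_max; have /andP[x01 _] := Hx ord0.
have LQ : is_lattice_path m (transfer_path 1 P).
  by apply: lattice_path_transfer => //; lia.
by split=> //; rewrite (RML_transfer m) ?RP.
Qed.

Lemma lowerP m r P : (0 < n)%N -> 0 < r ->
  is_lattice_path m P /\ RML P = r + 1 ->
  is_lattice_path m (lower P) /\ RML (lower P) = r.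
Proof.
move=> n0 r0 [LP RP]; have R0 : 0 < RML P by lia.
rewrite /lower; have [x0|x0] := eqVneq (xstep P ord0) 1.
  by split; [apply/lattice_path_rotl | rewrite (RML_rotl m) // RP x0 addrK].
have [_ _ Hx _] := LP; have /andP[xm1 _] := Hx ord_max; have /andP[x01 _] := Hx ord0.
have LQ : is_lattice_path m (transfer_path (-1) P).
  by apply: lattice_path_transfer => //; lia.
by split=> //; rewrite (RML_transfer m) // RP addrK.
Qed.

Lemma rotr_path1P m P : (1 < m)%N ->
  [/\ is_lattice_path m P, RML P = 0 & xstep P ord_max = 1] ->
  is_lattice_path m (rotr_path P) /\ RML (rotr_path P) = 1.
Proof.
move=> m1 [LP RP xm]; split; first exact/lattice_path_rotr.
by rewrite (RML_rotr m) ?RP ?xm.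
Qed.

Lemma rotl_path1P m P : is_lattice_path m P /\ RML P = 1 ->
  [/\ is_lattice_path m (rotl_path P), RML (rotl_path P) = 0
    & xstep (rotl_path P) ord_max = 1].
Proof.
move=> [LP RP]; have R0 : 0 < RML P by rewrite RP.
have [_ _ Hx _] := LP; have /andP[x01 _] := Hx ord0.
have x0 : xstep P ord0 = 1.
  by apply/le_anti; rewrite x01 andbT -RP; apply: xstep0_le_RML LP R0.
split; first exact/lattice_path_rotl.
- by rewrite (RML_rotl m) // RP x0.
- by rewrite xstep_rotl_max.
Qed.

End Paths.

(** * Counting *)

(** The maps are inverse only on [A] and [B], because [raise] and [lower] do not invert each other
    on arbitrary tuples. *)
Lemma card_fset_set_bij (T : choiceType) (A B : set T) (f g : T -> T) :
  finite_set A -> finite_set B ->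
  {homo f : x / A x >-> B x} -> {homo g : x / B x >-> A x} ->
  (forall x, A x -> g (f x) = x) -> (forall x, B x -> f (g x) = x) ->
  #|` fset_set A | = #|` fset_set B |.
Proof.
move=> finA finB fAB gBA fK gK; apply/fcard_eq => //.
have -> : B = (f @` A)%classic.
  apply/seteqP; split=> [y By|_ [x Ax <-]]; last exact: fAB.
  by exists (g y); [exact: gBA | exact: gK].
rewrite card_eq_sym; apply: inj_card_eq => x y /set_mem Ax /set_mem Ay eqf.
by rewrite -(fK x Ax) eqf fK.
Qed.

Lemma finite_lattice_subset (n m : nat) (A : set (lpath n)) :
  (forall P, A P -> is_lattice_path m P) -> finite_set A.
Proof. by move=> sA; apply: (sub_finite_set sA); apply: finite_lattice_paths. Qed.

Lemma card_RML_raise (n m : nat) (r : int) : (0 < n)%N -> 0 < r -> r + 1 < m%:Z ->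
  #|` fset_set [set P : lpath n | is_lattice_path m P /\ RML P = r]%classic | =
  #|` fset_set [set P : lpath n | is_lattice_path m P /\ RML P = r + 1]%classic |.
Proof.
move=> n0 r0 rm; apply: (card_fset_set_bij _ _ _ (raise n) (lower n)).
- by apply: (finite_lattice_subset n m) => P [].
- by apply: (finite_lattice_subset n m) => P [].
- by move=> P; apply: raiseP.
- by move=> P; apply: lowerP.
- by move=> P [LP _]; apply: raiseK LP.
- by move=> P [LP _]; apply: lowerK LP.
Qed.

Lemma card_RML1 (n m : nat) : (1 < m)%N ->
  #|` fset_set [set P : lpath n | is_lattice_path m P /\ RML P = 1]%classic | =
  #|` fset_set [set P : lpath n | [/\ is_lattice_path m P, RML P = 0
                                   & xstep P ord_max = 1] ]%classic |.
Proof.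
move=> m1; apply: (card_fset_set_bij _ _ _ (rotl_path n) (rotr_path n)).
- by apply: (finite_lattice_subset n m) => P [].
- by apply: (finite_lattice_subset n m) => P [].
- by move=> P; apply: rotl_path1P.
- by move=> P; apply: rotr_path1P.
- by move=> P _; apply: rotl_pathK.
- by move=> P _; apply: rotr_pathK.
Qed.

Theorem theorem2p12 (n m : nat) (n_gt0 : (0 < n)%N) (m_gt0 : (0 < m)%N)
    (le_nm : (n + 1 <= m)%N) :
  (forall r : int, 1 <= r <= m%:Z - 1 ->
     #|` fset_set [set P : lpath n | is_lattice_path m P /\ RML P = r]%classic | =
     #|` fset_set [set P : lpath n | [/\ is_lattice_path m P, RML P = 0
                                      & xstep P ord_max = 1] ]%classic |)
  /\
  (forall r r' : int, 1 <= r <= m%:Z - 1 -> 1 <= r' <= m%:Z - 1 ->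
     #|` fset_set [set P : lpath n | is_lattice_path m P /\ RML P = r]%classic | =
     #|` fset_set [set P : lpath n | is_lattice_path m P /\ RML P = r']%classic |).
Proof.
suff main r : 1 <= r <= m%:Z - 1 ->
    #|` fset_set [set P : lpath n | is_lattice_path m P /\ RML P = r]%classic | =
    #|` fset_set [set P : lpath n | [/\ is_lattice_path m P, RML P = 0
                                     & xstep P ord_max = 1] ]%classic |.
  by split=> // r r' /main -> /main ->.
(* Only the values [r.+1] satisfy the bounds. The induction starts at 1, reached by rotation alone,
   and climbs by [raise]. *)
case: r => [[|r]|r] //; elim: r => [|r IH] rm; first by apply: card_RML1; lia.
rewrite -IH; last by lia.
have -> : r.+2%:Z = r.+1%:Z + 1 by lia.
by apply/esym/card_RML_raise => //; lia.
Qed.
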